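(* There is no $3$-way $3$-homogeneous $(v,3,2)$ Steiner trade of volume $v$ for $v\in[1,7]\cup[10,15]\cup[19,23]\cup[28,31]\cup[37,39]\cup\{46,47,55\}$, where $[a,b]=\{c\in\mathbb{Z}: a\le c\le b\}$.
   Context: Let $V$ be a finite set with $v$ elements and let $t<k<v$ be positive integers. A $\mu$-way $(v,k,t)$ trade $T=\{T_1,\dots,T_\mu\}$ of volume $m$ consists of $\mu$ pairwise disjoint collections $T_1,\dots,T_\mu$, each of $m$ blocks ($k$-subsets of $V$), such that every $t$-subset of $V$ is contained in the same number of blocks in each $T_i$. The foundation $\mathrm{found}(T)$ is the set of elements covered by the blocks. It is a Steiner trade if every $t$-subset of $\mathrm{found}(T)$ is in at most one block of each $T_i$, and $d$-homogeneous if every element of $V$ lies in exactly $d$ blocks of each $T_i$. *)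

(* Defs.v *)
From mathcomp Require Import all_boot.
Set Implicit Arguments.
Unset Strict Implicit.
Unset Printing Implicit Defensive.

Section Trades.
Variables (V : finType) (mu : nat).

(* Collections of blocks are sets, without repeated blocks: in a Steiner trade
   a repeated block would violate the Steiner condition, because t < k. *)
Implicit Type T : 'I_mu -> {set {set V}}.

Definition blocks_containing (C : {set {set V}}) (S : {set V}) : {set {set V}} :=
  [set B in C | S \subset B].

(* A mu-way (#|V|, k, t) trade of volume m. *)
Definition is_trade (k t m : nat) T : Prop :=
  [/\ [&& 0 < t, t < k & k < #|V|],
      forall i, #|T i| = m,
      forall i (B : {set V}), B \in T i -> #|B| = k,
      forall i j, i != j -> [disjoint T i & T j]
    & forall S : {set V}, #|S| = t ->
        forall i j, #|blocks_containing (T i) S| = #|blocks_containing (T j) S|].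

Definition found T : {set V} := \bigcup_(i < mu) \bigcup_(B in T i) B.

Definition is_steiner (t : nat) T : Prop :=
  forall S : {set V}, S \subset found T -> #|S| = t ->
    forall i, #|blocks_containing (T i) S| <= 1.

Definition is_homogeneous (d : nat) T : Prop :=
  forall (x : V) i, #|[set B in T i | x \in B]| = d.

End Trades.

(* Main.v *)
Require Import Defs.
From mathcomp Require Import all_boot zify.

(** The listed volumes are exactly the positive integers not of the form
    [8m + 9n]. Join two points when a block covers both: this graph is the same
    for the three classes, is 6-regular, and every edge lies in at least three
    triangles, one in each class. Hence points at distance 2 have at least
    three common neighbours, and no two points are at distance 3, so a component
    has [7 + s] points, where [s] points are at distance 2 from a given [x].
    Counting the edges between the neighbours of [x] (at most 2 from each) and
    these [s] points gives [s <= 4]; for [s = 3] and [s = 4] equality holds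
    throughout, so every edge lies in exactly three triangles, all of them
    blocks, and the points at distance 2 from [x] are pairwise adjacent, which
    forces a K4, impossible since its four triangles would need four classes.
    For [s = 0] the classes restrict to three disjoint Fano planes on 7 points,
    and there are no such planes. So every component has 8 or 9 points. *)

Set Implicit Arguments.
Unset Strict Implicit.
Unset Printing Implicit Defensive.

(** * Enumeration of the Fano planes on seven labelled points *)

Definition pairs7 : seq (seq nat) :=
  [seq [:: i; j] | i <- iota 0 7, j <- iota i.+1 (6 - i)].

Definition triples7 : seq (seq nat) :=
  [seq i :: p | i <- iota 0 7, p <- [seq p <- pairs7 | i < head 0 p]].

(** The test is [!= 2] rather than [<= 1] so that a line already in [c] can be chosen again for
    another of its pairs. *)
Definition extend (p : seq nat) (cs : seq (seq (seq nat))) :=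
  [seq t :: c | c <- cs,
     t <- [seq t <- triples7 | all [in t] p && all (fun s => count [in s] t != 2) c]].

(* Every Fano plane on [0 .. 6], as a list of lines in which each line occurs
   once for each of its pairs. *)
Definition fano7 := foldr extend [:: [::]] pairs7.

Definition meet (c d : seq (seq nat)) := has [in c] d.

(** Settled by exhaustive evaluation. Taking the same [d] twice is harmless, since a nonempty list
    meets itself. *)
Lemma fano7_disjoint_check :
  all (fun c => all (fun d => all (meet d) [seq d <- fano7 | ~~ meet c d])
                    [seq d <- fano7 | ~~ meet c d]) fano7.
Proof. by vm_compute. Qed.

Lemma no_three_disjoint_fano7 c1 c2 c3 :
  c1 \in fano7 -> c2 \in fano7 -> c3 \in fano7 ->
  [|| meet c1 c2, meet c1 c3 | meet c2 c3].
Proof.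
move: fano7 fano7_disjoint_check => F /allP H m1 m2 m3.
case: (boolP (meet c1 c2)) => //= n12; case: (boolP (meet c1 c3)) => //= n13.
have d2 : c2 \in [seq d <- F | ~~ meet c1 d] by rewrite mem_filter n12.
have d3 : c3 \in [seq d <- F | ~~ meet c1 d] by rewrite mem_filter n13.
by move/allP: (H c1 m1) => /(_ c2 d2)/allP/(_ c3 d3).
Qed.

(** Choosing for each pair a triple of [P] through it gives a list that passes every filter of
    [extend]. An inclusion is all that is needed to carry disjointness over to the enumerated
    planes. *)
Lemma fano7_complete (P : pred (seq nat)) :
  (forall p, p \in pairs7 -> exists2 t, t \in triples7 & all [in t] p && P t) ->
  (forall s t, s \in triples7 -> t \in triples7 -> P s -> P t ->
     count [in s] t != 2) ->
  exists2 c, c \in fano7 & {subset c <= [seq t <- triples7 | P t]}.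
Proof.
rewrite /fano7 /extend; move: triples7 => tr7 cover compat.
(* Induction on the list of pairs treated so far, remembering that they belong to [pairs7] so that
   [cover] applies. *)
have : {subset pairs7 <= pairs7} by [].
move: {1 3}pairs7; elim=> [|p ps IHps] sub /=; first by exists [::].
have [|c cF sc] := IHps; first by move=> q qs; apply: sub; rewrite inE qs orbT.
have [|t tt /andP[pt Pt]] := cover p; first by rewrite sub ?mem_head.
exists (t :: c); last first.
  by move=> s; rewrite inE => /predU1P[->|/sc //]; rewrite mem_filter Pt.
apply/allpairsPdep; exists c, t; split=> //.
rewrite mem_filter pt tt andbT /=; apply/allP=> s /sc; rewrite mem_filter.
by case/andP=> Ps s7; apply: compat.
Qed.

Lemma pairs7P p : p \in pairs7 ->
  exists i j, [/\ p = [:: i; j], i < 7, j < 7 & i != j].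
Proof.
case/allpairsPdep=> i [j [+ + ->]]; rewrite !mem_iota => i7 j7.
by exists i, j; split=> //; lia.
Qed.

Lemma triples7P t : t \in triples7 -> [/\ uniq t, size t = 3 & {in t, forall i, i < 7}].
Proof.
have /allP H : all (fun t => [&& uniq t, size t == 3 & all (ltn^~ 7) t]) triples7.
  by vm_compute.
by case/H/and3P=> ? /eqP ? /allP.
Qed.

Lemma triples7_complete p k : p \in pairs7 -> k < 7 -> k \notin p ->
  exists2 t, t \in triples7 & perm_eq (k :: p) t.
Proof.
have /allP H : all (fun p => all (fun k => (k \in p) || has (perm_eq (k :: p)) triples7)
                       (iota 0 7)) pairs7 by vm_compute.
move=> /H/allP/(_ k); rewrite mem_iota => /[apply] /orP[->//|/hasP[t]] .
by exists t.
Qed.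

(** * The graph of covered pairs and its triangles *)

Section PairGraph.

Variables (V : finType) (T : 'I_3 -> {set {set V}}).
Hypothesis block_card : forall i (B : {set V}), B \in T i -> #|B| = 3.
Hypothesis T_disjoint : forall i j, i != j -> [disjoint T i & T j].
Hypothesis T_balanced : forall S : {set V}, #|S| = 2 ->
  forall i j, #|blocks_containing (T i) S| = #|blocks_containing (T j) S|.
Hypothesis T_simple : forall S : {set V}, #|S| = 2 ->
  forall i, #|blocks_containing (T i) S| <= 1.
Hypothesis T_hom : is_homogeneous 3 T.

Definition adj : rel V :=
  fun x y => (x != y) && (blocks_containing (T ord0) [set x; y] != set0).

Definition nbrs (x : V) : {set V} := [set y | adj x y].

Lemma adj_sym x y : adj x y = adj y x.
Proof. by rewrite /adj eq_sym setUC. Qed.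

Lemma adjxx x : adj x x = false.
Proof. by rewrite /adj eqxx. Qed.

Lemma adj_neq x y : adj x y -> x != y.
Proof. by case/andP. Qed.

(** The Steiner condition caps the count at 1, and balance carries it from [ord0] to every class, so
    it is the boolean [adj x y] read as a number. *)
Lemma card_blocks_containing2 x y i : x != y ->
  #|blocks_containing (T i) [set x; y]| = adj x y.
Proof.
move=> nxy; have c2 : #|[set x; y]| = 2 by rewrite cards2 nxy.
rewrite (T_balanced c2 i ord0) /adj nxy -cards_eq0.
by case: (#|_|) (T_simple c2 ord0) => [|[]].
Qed.

Lemma block_adj i B x y : B \in T i -> x \in B -> y \in B -> x != y -> adj x y.
Proof.
move=> Bi xB yB nxy; rewrite -[adj x y]lt0b -(card_blocks_containing2 i nxy).
apply/card_gt0P; exists B; rewrite inE Bi /=.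
by apply/subsetP=> z /set2P[] ->.
Qed.

Lemma block_inj i x y B B' : x != y -> B \in T i -> B' \in T i ->
  [set x; y] \subset B -> [set x; y] \subset B' -> B = B'.
Proof.
move=> nxy Bi Bi' sB sB'.
have c2 : #|[set x; y]| = 2 by rewrite cards2 nxy.
by move/card_le1_eqP: (T_simple c2 i); apply; rewrite inE ?Bi ?Bi'.
Qed.

Lemma third_inj i x y z w : x != y ->
  z \notin [set x; y] -> [set x; y; z] \in T i -> [set x; y; w] \in T i -> z = w.
Proof.
move=> nxy zxy Bz Bw.
have E : [set x; y; z] = [set x; y; w].
  by apply: (block_inj nxy Bz Bw); rewrite subsetUl.
have : z \in [set x; y; w] by rewrite -E !inE eqxx orbT.
by rewrite inE (negPf zxy) => /set1P.
Qed.

Lemma third_class_inj i j x y z : [set x; y; z] \in T i -> [set x; y; z] \in T j -> i = j.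
Proof.
move=> Bi Bj; apply/eqP; apply: contraTT Bj => nij.
by rewrite (disjointFr (T_disjoint nij) Bi).
Qed.

Lemma adj_third i x y : adj x y ->
  exists z, [&& adj x z, adj y z & [set x; y; z] \in T i].
Proof.
move=> axy; have nxy := adj_neq axy.
have : 0 < #|blocks_containing (T i) [set x; y]|.
  by rewrite card_blocks_containing2 // axy.
case/card_gt0P=> B; rewrite inE => /andP[Bi sB].
have := cardsD B [set x; y]; rewrite (setIidPr sB) (block_card Bi) cards2 nxy.
move=> /eqP/cards1P[z Ez].
have : z \in B :\: [set x; y] by rewrite Ez inE.
rewrite !inE negb_or => /andP[/andP[nzx nzy] zB].
have xB : x \in B by rewrite (subsetP sB) // !inE eqxx.
have yB : y \in B by rewrite (subsetP sB) // !inE eqxx orbT.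
exists z; apply/and3P; split.
- by apply: (block_adj Bi); rewrite // eq_sym.
- by apply: (block_adj Bi); rewrite // eq_sym.
- by rewrite -Ez -{1}(setIidPr sB) setID.
Qed.

(** Double counting of the pairs of a block of [T ord0] through [x] and another point of it: three
    blocks with two points each, and each neighbour in just one of them. *)
Lemma card_nbrs x : #|nbrs x| = 6.
Proof.
pose P B := (B \in T ord0) && (x \in B).
transitivity (\sum_(B | P B) \sum_(y in [set~ x]) (y \in B : nat)); last first.
  transitivity (\sum_(B | P B) 2).
    apply: eq_bigr => B /andP[B0 xB].
    rewrite -big_mkcondr /= sum1_card.
    have := cardsD1 x B; rewrite xB (block_card B0) add1n => -[->].
    by apply: eq_card => y; rewrite unfold_in !inE.
  rewrite sum_nat_const -[6]/(3 * 2); congr (_ * _).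
  by rewrite -[RHS](T_hom x ord0); apply: eq_card => B; rewrite !inE.
rewrite exchange_big /= -sum1_card big_mkcond [RHS]big_mkcond /=.
apply: eq_bigr => y _; rewrite !inE; case: (eqVneq y x) => [->|nyx] /=.
  by rewrite adjxx.
rewrite -big_mkcondr /= sum1_card.
rewrite (_ : #|_| = adj x y); first by case: adj.
rewrite -(card_blocks_containing2 ord0) 1?eq_sym //.
by apply: eq_card => B; rewrite unfold_in /P !inE subUset !sub1set andbA.
Qed.

(** [f i] is the third point of the block of class [i] through the edge; two equal values would put
    one block in two classes. *)
Lemma card_common_nbrs x y : adj x y ->
  exists f : 'I_3 -> V, [/\ injective f,
    forall i, [set x; y; f i] \in T i & f @: 'I_3 \subset nbrs x :&: nbrs y].
Proof.
move=> axy; have nxy := adj_neq axy.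
pose f i := xchoose (adj_third i axy).
have fP i : [&& adj x (f i), adj y (f i) & [set x; y; f i] \in T i].
  exact: (xchooseP (adj_third i axy)).
exists f; split=> [i j|i|].
- have /and3P[_ _ Ti] := fP i; have /and3P[_ _ Tj] := fP j => Ef.
  by apply: third_class_inj Ti _; rewrite Ef.
- by case/and3P: (fP i).
- by apply/subsetP=> _ /imsetP[i _ ->]; rewrite !inE; case/and3P: (fP i) => -> ->.
Qed.

Lemma common_nbrs_ge3 x y : adj x y -> 3 <= #|nbrs x :&: nbrs y|.
Proof.
case/card_common_nbrs=> f [finj _ /subset_leq_card].
by rewrite card_imset // card_ord.
Qed.

Lemma common_nbrs3_block x y z : adj x y -> #|nbrs x :&: nbrs y| = 3 ->
  adj x z -> adj y z -> exists i, [set x; y; z] \in T i.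
Proof.
case/card_common_nbrs=> f [finj fT sf] c3 axz ayz.
have /eqP Ef : f @: 'I_3 == nbrs x :&: nbrs y.
  by rewrite eqEcard sf c3 card_imset // card_ord.
have : z \in nbrs x :&: nbrs y by rewrite !inE axz ayz.
by rewrite -Ef => /imsetP[i _ ->]; exists i.
Qed.

(* The four triangles of a K4 pairwise share an edge, hence would lie in four
   different classes [T i]. *)
Lemma no_K4 a b c d :
  (forall x y, x \in [:: a; b; c; d] -> y \in [:: a; b; c; d] ->
     adj x y -> #|nbrs x :&: nbrs y| = 3) ->
  adj a b -> adj a c -> adj a d -> adj b c -> adj b d -> adj c d -> False.
Proof.
move=> H ab ac ad bc bd cd.
have tri x y z : x \in [:: a; b; c; d] -> y \in [:: a; b; c; d] ->
    adj x y -> adj x z -> adj y z -> exists i, [set x; y; z] \in T i.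
  by move=> xs ys xy; apply: common_nbrs3_block (xy) (H x y xs ys xy).
have [i Ti] : exists i, [set a; b; c] \in T i.
  by apply: tri; rewrite // !inE eqxx ?orbT.
have [j Tj] : exists i, [set a; b; d] \in T i.
  by apply: tri; rewrite // !inE eqxx ?orbT.
have [k Tk] : exists i, [set a; c; d] \in T i.
  by apply: tri; rewrite // !inE eqxx ?orbT.
have [l Tl] : exists i, [set b; c; d] \in T i.
  by apply: tri; rewrite // !inE eqxx ?orbT.
have [[nab nac] nad] := (adj_neq ab, adj_neq ac, adj_neq ad).
have [[nbc nbd] ncd] := (adj_neq bc, adj_neq bd, adj_neq cd).
have rot3 x y z : [set x; y; z] = [set x; z; y] by rewrite setUAC.
have rotl x y z : [set x; y; z] = [set y; z; x] by rewrite -setUA setUC.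
have share m x y z w : z \notin [set x; y] -> x != y -> z != w ->
    [set x; y; z] \in T m -> [set x; y; w] \in T m -> False.
  by move=> zxy nxy nzw Tz Tw; rewrite (third_inj nxy zxy Tz Tw) eqxx in nzw.
have nij : i != j.
  apply/eqP=> E; move: Tj; rewrite -E; apply: (share i a b c d) => //.
  by rewrite !inE negb_or ![c == _]eq_sym nac nbc.
have nik : i != k.
  apply/eqP=> E; move: Tk; rewrite -E; apply: (share i a c b d) => //; last by rewrite rot3.
  by rewrite !inE negb_or [b == a]eq_sym nab nbc.
have nil : i != l.
  apply/eqP=> E; move: Tl; rewrite -E; apply: (share i b c a d) => //; last by rewrite -rotl.
  by rewrite !inE negb_or nab nac.
have njk : j != k.
  apply/eqP=> E; move: Tk; rewrite -E rot3; apply: (share j a d b c) => //; last by rewrite rot3.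
  by rewrite !inE negb_or [b == a]eq_sym nab nbd.
have njl : j != l.
  apply/eqP=> E; move: Tl; rewrite -E rot3; apply: (share j b d a c) => //; last by rewrite -rotl.
  by rewrite !inE negb_or nab nad.
have nkl : k != l.
  apply/eqP=> E; move: Tl; rewrite -E rotl; apply: (share k c d a b) => //; last by rewrite -rotl.
  by rewrite !inE negb_or nac nad.
have : uniq [:: i; j; k; l] by rewrite /= !inE !negb_or nij nik nil njk njl nkl.
by move/card_uniqP=> /= E; have := max_card [in [:: i; j; k; l]]; rewrite E card_ord.
Qed.

(** Inside the four neighbours of [y] other than [x] and [z], two sets of size at least 3 meet in at
    least two points; [y] itself is the third common neighbour. *)
Lemma distance2_common_nbrs x y z : adj x y -> adj y z -> z != x -> ~~ adj x z ->
  3 <= #|nbrs x :&: nbrs z|.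
Proof.
move=> axy ayz nzx naxz.
have ayx : adj y x by rewrite adj_sym.
pose A := nbrs y :&: nbrs x; pose B := nbrs y :&: nbrs z.
have cA : 3 <= #|A| by apply: common_nbrs_ge3.
have cB : 3 <= #|B| by apply: common_nbrs_ge3.
have sub : A :|: B \subset nbrs y :\ x :\ z.
  apply/subsetP=> w; rewrite !inE => /orP[] /andP[-> aw]; rewrite andbT.
    by apply/andP; split; apply: contraTneq aw => ->; rewrite ?adjxx.
  by apply/andP; split; apply: contraTneq aw => ->; rewrite ?adjxx // adj_sym.
have c4 : #|nbrs y :\ x :\ z| = 4.
  have := card_nbrs y; rewrite (cardsD1 x) inE ayx (cardsD1 z (_ :\ _)) !inE nzx ayz.
  by move=> [].
have := subset_leq_card sub; rewrite c4 => cU.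
have := cardsUI A B => cUI.
have sI : y |: A :&: B \subset nbrs x :&: nbrs z.
  apply/subsetP=> w; rewrite !inE => /orP[/eqP->|/andP[/andP[_ ->] /andP[_ ->]] //].
  by rewrite axy adj_sym.
have := subset_leq_card sI; rewrite cardsU1 !inE adjxx /=; lia.
Qed.

(** * Components of the graph *)

(** Distance at most 2. This turns out to be transitive, so [class x] is the component of [x] and
    [far x] its points at distance exactly 2. *)
Definition linked : rel V :=
  fun x y => [|| x == y, adj x y | nbrs x :&: nbrs y != set0].

Definition class (x : V) : {set V} := [set y | linked x y].

Definition far (x : V) : {set V} := class x :\: (x |: nbrs x).

Lemma linked_refl x : linked x x. Proof. by rewrite /linked eqxx. Qed.

Lemma linked_sym x y : linked x y = linked y x.
Proof. by rewrite /linked eq_sym adj_sym setIC. Qed.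

Lemma linked2 x y z : adj x y -> adj y z -> linked x z.
Proof.
move=> axy ayz; apply/or3P; apply: Or33.
by apply/set0Pn; exists y; rewrite !inE axy adj_sym.
Qed.

Lemma linked1 x y : adj x y -> linked x y.
Proof. by move=> axy; apply/or3P; apply: Or32. Qed.

(* If [w] were at distance 3 from [x], then inside the 6-set [nbrs z] the point
   [w] and the two triples of common neighbours with [x] and with [w] would be
   disjoint. *)
Lemma linked_step x z w : linked x z -> adj z w -> linked x w.
Proof.
case/or3P=> [/eqP<- /linked1 //|axz /(linked2 axz) //|].
case/set0Pn=> y; rewrite !inE => /andP[axy azy] azw.
have ayz : adj y z by rewrite adj_sym.
have [E|nzx] := eqVneq z x; first by apply: linked1; rewrite -E.
case: (boolP (adj x z)) => [/linked2/(_ azw) // | naxz].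
rewrite /linked; have [//|nxw] := eqVneq x w.
case: (boolP (adj x w)) => [//|naxw] /=; apply/negP=> /eqP E.
have c1 := distance2_common_nbrs axy ayz nzx naxz.
have c2 := common_nbrs_ge3 azw.
have dis : (nbrs x :&: nbrs z) :&: (nbrs z :&: nbrs w) = set0.
  by apply/eqP; rewrite -subset0 -E; apply/subsetP=> u; rewrite !inE => /andP[/andP[-> _] /andP[_ ->]].
have sub : w |: ((nbrs x :&: nbrs z) :|: (nbrs z :&: nbrs w)) \subset nbrs z.
  apply/subsetP=> u; rewrite !inE.
  by case/or3P=> [/eqP->|/andP[]|/andP[]].
have := subset_leq_card sub; rewrite card_nbrs cardsU1 cardsU dis cards0 !inE.
by rewrite (negPf naxw) adjxx !andbF /=; lia.
Qed.

Lemma linked_trans x y z : linked x y -> linked y z -> linked x z.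
Proof.
move=> lxy /or3P[/eqP<- //|/(linked_step lxy) //|].
case/set0Pn=> u; rewrite !inE => /andP[/(linked_step lxy) lxu azu].
by apply: linked_step lxu _; rewrite adj_sym.
Qed.

Lemma class_eq x y : y \in class x -> class y = class x.
Proof.
rewrite inE => lxy; apply/setP=> z; rewrite !inE; apply/idP/idP.
  exact: linked_trans.
by apply: linked_trans; rewrite linked_sym.
Qed.

Lemma nbrs_sub_class x y : y \in class x -> nbrs y \subset class x.
Proof. by rewrite inE => lxy; apply/subsetP=> z; rewrite !inE; apply: linked_step. Qed.

(** * Edge counts inside a component *)

Lemma card_class x : #|class x| = 7 + #|far x|.
Proof.
rewrite /far cardsD (setIidPr _).
  rewrite cardsU1 card_nbrs inE adjxx /= subnKC //.
  rewrite -[7]/(1 + 6) -(card_nbrs x) -[1]/(nat_of_bool (~~ false)) -(adjxx x).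
  rewrite -{1}[adj x x](in_set (adj x)) -cardsU1; apply: subset_leq_card.
  by rewrite subUset sub1set inE linked_refl nbrs_sub_class // inE linked_refl.
by rewrite subUset sub1set inE linked_refl nbrs_sub_class // inE linked_refl.
Qed.

(** The neighbours of [y] stay in [class x], which splits into [x], [nbrs x] and [far x]. *)
Lemma card_nbrs_split x y : y \in class x ->
  6 = adj x y + #|nbrs y :&: nbrs x| + #|nbrs y :&: far x|.
Proof.
move=> yC; rewrite -(card_nbrs y) -(cardsID (x |: nbrs x) (nbrs y)).
congr (_ + _).
  rewrite setIUr cardsU -setIIr.
  have -> : [set x] :&: nbrs x = set0.
    by apply/setP=> z; rewrite !inE; case: eqP => // ->; rewrite adjxx.
  rewrite setI0 cards0 subn0; congr (_ + _).
  rewrite setIC; case: (boolP (adj x y)) => axy.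
    by rewrite (setIidPl _) ?cards1 // sub1set inE adj_sym.
  apply/eqP; rewrite cards_eq0 -subset0; apply/subsetP=> z.
  by rewrite !inE => /andP[/eqP->]; rewrite adj_sym (negPf axy).
by rewrite /far setIDA (setIidPl (nbrs_sub_class yC)).
Qed.

Lemma far_props x z : z \in far x -> [/\ z \in class x, adj x z = false,
  3 <= #|nbrs z :&: nbrs x| & #|nbrs z :&: far x| <= #|far x|.-1].
Proof.
move=> zD; have := zD; rewrite !inE negb_or => /andP[/andP[nzx /negPf naxz] lxz].
split=> //.
  move: lxz; rewrite /linked eq_sym (negPf nzx) naxz /= => /set0Pn[y].
  rewrite !inE => /andP[axy azy]; rewrite setIC.
  by apply: (@distance2_common_nbrs x y); rewrite ?naxz // adj_sym.
rewrite (cardsD1 z (far x)) zD /= subset_leq_card //.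
by apply/subsetP=> y; rewrite !inE => /andP[azy ->]; rewrite andbT eq_sym adj_neq.
Qed.

Lemma edges_nbrs_far x : \sum_(z in far x) #|nbrs z :&: nbrs x| =
  \sum_(y in nbrs x) #|nbrs y :&: far x|.
Proof.
have E (A B : {set V}) : \sum_(z in A) #|nbrs z :&: B| =
    \sum_(z in A) \sum_(y in B) (adj z y : nat).
  apply: eq_bigr => z _; rewrite -sum1_card big_mkcond [RHS]big_mkcond /=.
  by apply: eq_bigr => y _; rewrite !inE; case: (y \in B); case: (adj z y).
rewrite !E exchange_big /=; apply: eq_bigr => y _; apply: eq_bigr => z _.
by rewrite adj_sym.
Qed.

Lemma nbr_far_le2 x y : adj x y -> #|nbrs y :&: far x| <= 2.
Proof.
move=> axy; have := @card_nbrs_split x y; rewrite inE linked1 // axy => /(_ isT).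
by have := common_nbrs_ge3 axy; rewrite setIC; lia.
Qed.

Lemma sum_nbr_far_le12 x : \sum_(y in nbrs x) #|nbrs y :&: far x| <= 12.
Proof.
rewrite -[12]/(6 * 2) -(card_nbrs x) -sum_nat_const.
by apply: leq_sum => y; rewrite inE; apply: nbr_far_le2.
Qed.

Lemma card_far_le4 x : #|far x| <= 4.
Proof.
have : #|far x| * 3 <= 12; last by lia.
apply: leq_trans (sum_nbr_far_le12 x); rewrite -edges_nbrs_far -sum_nat_const.
by apply: leq_sum => z /far_props[].
Qed.

(** With [s] far points, each has at most [s - 1] far neighbours, hence at least [7 - s] in
    [nbrs x]. For [s] equal to 3 or 4 the total [s * (7 - s)] already reaches the upper bound 12. *)
Lemma far_extremal x : 3 <= #|far x| ->
  (forall y, adj x y -> #|nbrs x :&: nbrs y| = 3) /\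
  (forall y z, y \in far x -> z \in far x -> y != z -> adj y z).
Proof.
move=> ge3; have le4 := card_far_le4 x; set s := #|far x| in ge3 le4.
have s12 : s * (7 - s) = 12.
  by case: s ge3 le4 => [|[|[|[|[|]]]]].
have lo z : z \in far x -> 7 - s <= #|nbrs z :&: nbrs x|.
  move=> /far_props[zC naxz _]; rewrite -/s.
  by have := card_nbrs_split zC; rewrite naxz; lia.
have hi y : y \in nbrs x -> #|nbrs y :&: far x| <= 2.
  by rewrite inE; apply: nbr_far_le2.
(* The equality case of [leqif_sum] turns equality of the sums into equality term by term. *)
have [le1 eq1] : \sum_(z in far x) (7 - s) <= \sum_(z in far x) #|nbrs z :&: nbrs x|
    ?= iff [forall (z | z \in far x), 7 - s == #|nbrs z :&: nbrs x|].
  by apply: leqif_sum => z zD; split; [apply: lo|].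
have [le2 eq2] : \sum_(y in nbrs x) #|nbrs y :&: far x| <= \sum_(y in nbrs x) 2
    ?= iff [forall (y | y \in nbrs x), #|nbrs y :&: far x| == 2].
  by apply: leqif_sum => y yN; split; [apply: hi|].
rewrite !sum_nat_const card_nbrs -/s s12 edges_nbrs_far in le1 eq1 le2 eq2.
have E : \sum_(y in nbrs x) #|nbrs y :&: far x| = 12 by lia.
rewrite E eqxx in eq1 eq2.
have {}eq1 := forall_inP (esym eq1); have {}eq2 := forall_inP (esym eq2).
split=> [y axy|y z yD zD nyz].
  have := @card_nbrs_split x y; rewrite inE linked1 // axy => /(_ isT).
  have := eq2 y; rewrite inE axy => /(_ isT)/eqP ->; rewrite [nbrs x :&: _]setIC; lia.
have [yC naxy _ _] := far_props yD.
have /eqP Ey : nbrs y :&: far x == far x :\ y.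
  rewrite eqEcard; apply/andP; split.
    apply/subsetP=> u; rewrite !inE => /andP[ayu ->].
    by rewrite andbT eq_sym adj_neq.
  have := card_nbrs_split yC; rewrite naxy -(eqP (eq1 y yD)).
  by have := cardsD1 y (far x); rewrite yD -/s; lia.
have : z \in far x :\ y by rewrite in_setD1 eq_sym nyz.
by rewrite -Ey inE => /andP[]; rewrite inE.
Qed.

(** The third points [f i] over an edge [x y] are pairwise nonadjacent, as two adjacent ones would
    complete a K4. Sharing the neighbour [x], two of them are far from the remaining one, so
    extremality makes them adjacent. *)
Lemma card_far_le2 x : #|far x| <= 2.
Proof.
rewrite leqNgt; apply/negP=> far3.
(* Points of one component have equally many far points, so extremality holds at each of them. *)
have ext y : y \in class x ->
    (forall z, adj y z -> #|nbrs y :&: nbrs z| = 3) /\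
    (forall z t, z \in far y -> t \in far y -> z != t -> adj z t).
  move=> yC; apply: far_extremal; have := card_class y.
  by rewrite (class_eq yC) card_class => /addnI <-.
have K4 y a b : adj x y -> adj x a -> adj y a -> adj x b -> adj y b -> adj a b -> False.
  move=> xy xa ya xb yb ab; apply: (@no_K4 x y a b) => // u w us _ uw.
  apply: (ext u _).1 => //; rewrite inE.
  by move: us; rewrite !inE => /or4P[] /eqP->; rewrite ?linked_refl ?linked1.
have : 0 < #|nbrs x| by rewrite card_nbrs.
case/card_gt0P=> y; rewrite inE => axy.
have [f [finj _ /subsetP fN]] := card_common_nbrs axy.
have fadj i : adj x (f i) /\ adj y (f i).
  by have /fN := imset_f f (isT : i \in 'I_3); rewrite !inE => /andP.
pose i0 := @Ordinal 3 0 isT; pose i1 := @Ordinal 3 1 isT; pose i2 := @Ordinal 3 2 isT.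
have nadj i j : ~ adj (f i) (f j).
  by have [[? ?] [? ?]] := (fadj i, fadj j); apply: (K4 y).
have inD i j : i != j -> f j \in far (f i).
  move=> nij; rewrite !inE negb_or (inj_eq finj) eq_sym nij.
  have [[xi _] [xj _]] := (fadj i, fadj j).
  by rewrite (@linked2 _ x) // 1?adj_sym // andbT; apply/negP; apply: nadj.
apply: (@nadj i1 i2); apply: (ext (f i0) _).2; rewrite ?inD ?(inj_eq finj) //.
by rewrite inE linked1 //; case: (fadj i0).
Qed.

(** * Excluding components of seven points *)

Lemma card_class_neq7 x : #|class x| != 7.
Proof.
apply/eqP=> c7; have adjC y z : y \in class x -> z \in class x -> y != z -> adj y z.
  move=> yC zC nyz.
  have /eqP : #|far y| = 0 by have := card_class y; rewrite (class_eq yC) c7; lia.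
  rewrite cards_eq0 => /eqP/setP/(_ z); rewrite /far (class_eq yC) in_setD zC.
  by rewrite !inE eq_sym (negPf nyz) andbT => /negbFE.
(* Labels the component by 0 to 6; the default [x] is never reached for these indices. *)
pose p := nth x (enum (class x)).
have size7 : size (enum (class x)) = 7 by rewrite -cardE.
have pC k : k < 7 -> p k \in class x by rewrite -mem_enum -size7 => /(mem_nth x).
have pI i j : i < 7 -> j < 7 -> (p i == p j) = (i == j).
  by rewrite -size7 => i7 j7; rewrite nth_uniq ?enum_uniq.
pose line t := [set y in map p t].
have line_pair i j t : i \in t -> j \in t -> [set p i; p j] \subset line t.
  by move=> it jt; rewrite subUset !sub1set !inE !map_f.
have plane i : exists2 c, c \in fano7 & {subset c <= [seq t <- triples7 | line t \in T i]}.
  apply: fano7_complete => [q q7|s t s7 t7 Ps Pt].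
    have [j [k [Eq j7 k7 njk]]] := pairs7P q7.
    have [|z /and3P[ajz akz Bz]] := @adj_third i (p j) (p k).
      by apply: adjC; rewrite ?pC ?pI.
    have zC : z \in class x.
      by apply: (subsetP (nbrs_sub_class (pC j j7))); rewrite inE.
    have [l l7 El] : exists2 l, l < 7 & z = p l.
      exists (index z (enum (class x))); last by rewrite /p nth_index ?mem_enum.
      by rewrite -size7 index_mem mem_enum.
    have lq : l \notin q.
      rewrite Eq !inE negb_or -!pI // -El [z == p j]eq_sym [z == p k]eq_sym.
      by rewrite !adj_neq.
    have [t t7 pt] := triples7_complete q7 l7 lq.
    exists t => //; apply/andP; split.
      by apply/allP=> m mq; rewrite /= -(perm_mem pt) inE mq orbT.
    rewrite (_ : line t = [set p j; p k; z]) //; apply/setP=> y.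
    rewrite inE -(perm_mem (perm_map p pt)) Eq El !inE.
    by rewrite orbC.
  have [[us _ s_lt] [ut sz_t t_lt]] := (triples7P s7, triples7P t7).
  apply/negP; rewrite -size_filter => /eqP.
  case E : (filter _ _) => [|a [|b []]] // _.
  have /filter_uniq uf := ut; have := uf [in s]; rewrite E /= inE andbT => nab.
  have : a \in [:: a; b] by rewrite mem_head.
  rewrite -E mem_filter => /andP[sa ta].
  have : b \in [:: a; b] by rewrite !inE eqxx orbT.
  rewrite -E mem_filter => /andP[sb tb].
  (* Two blocks of one class sharing two points coincide, so all three entries of [t] lie in [s],
     against the assumed count of 2. *)
  have Est : line t = line s.
    by apply: (@block_inj i (p a) (p b)); rewrite ?line_pair ?pI ?t_lt.
  have : size [seq m <- t | m \in s] = 3.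
    rewrite -sz_t; congr size; apply/all_filterP/allP=> m mt.
    have : p m \in line t by rewrite inE map_f.
    rewrite Est inE => /mapP[n ns /eqP]; rewrite (pI _ _ (t_lt m mt) (s_lt n ns)) => /eqP->.
    exact: ns.
  by rewrite E.
have disj i j c d : i != j -> {subset c <= [seq t <- triples7 | line t \in T i]} ->
    {subset d <= [seq t <- triples7 | line t \in T j]} -> ~~ meet c d.
  move=> nij sc sd; apply/hasPn=> t /sd; rewrite mem_filter => /andP[Tj _].
  apply/negP=> /sc; rewrite mem_filter => /andP[Ti _].
  by rewrite (disjointFr (T_disjoint nij) Ti) in Tj.
have [c1 F1 s1] := plane (@Ordinal 3 0 isT).
have [c2 F2 s2] := plane (@Ordinal 3 1 isT).
have [c3 F3 s3] := plane (@Ordinal 3 2 isT).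
have := no_three_disjoint_fano7 F1 F2 F3; apply/negP; rewrite !negb_or.
by rewrite (disj _ _ _ _ _ s1 s2) // (disj _ _ _ _ _ s1 s3) // (disj _ _ _ _ _ s2 s3).
Qed.

(** * Component sizes and the total number of points *)

Lemma card_class89 x : 8 <= #|class x| <= 9.
Proof.
have := card_class_neq7 x; rewrite card_class.
by have := card_far_le2 x; lia.
Qed.

Lemma card_points89 : exists m n, #|V| = 8 * m + 9 * n.
Proof.
pose P := equivalence_partition linked [set: V].
have partP : partition P [set: V].
  apply: equivalence_partitionP => x y z _ _ _; split=> [|lxy]; first exact: linked_refl.
  apply/idP/idP; first by apply: linked_trans; rewrite linked_sym.
  exact: linked_trans.
rewrite -cardsT (card_partition partP).
have : forall A, A \in P -> 8 <= #|A| <= 9.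
  move=> _ /imsetP[x _ ->]; rewrite (_ : [set _ in _ | _] = class x) ?card_class89 //.
  by apply/setP=> y; rewrite !inE.
move=> H; elim/big_ind: _ => [|_ _ [m1 [n1 ->]] [m2 [n2 ->]]|A /H].
- by exists 0, 0.
- by exists (m1 + m2), (n1 + n2); lia.
(* The witnesses are 1 and 0 for a component of 8 points, 0 and 1 for one of 9. *)
- by case/andP=> ge8 le9; exists (9 - #|A|), (#|A| - 8); lia.
Qed.

End PairGraph.

Theorem theorem2p7 (v : nat)
    (hv : [|| 1 <= v <= 7, 10 <= v <= 15, 19 <= v <= 23, 28 <= v <= 31,
              37 <= v <= 39 | v \in [:: 46; 47; 55]])
    (V : finType) (hV : #|V| = v) :
  ~ exists T : 'I_3 -> {set {set V}},
      [/\ is_trade 3 2 v T, is_steiner 2 T & is_homogeneous 3 T].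
Proof.
case=> T [[_ _ block_card T_disjoint T_balanced] steiner hom].
(* Homogeneity puts every point in a block, so the Steiner condition applies to all pairs of [V]. *)
have foundT (S : {set V}) : S \subset found T.
  apply/subsetP=> x _; have : 0 < #|[set B in T ord0 | x \in B]| by rewrite hom.
  case/card_gt0P=> B; rewrite inE => /andP[B0 xB].
  by apply/bigcupP; exists ord0 => //; apply/bigcupP; exists B.
have T_simple (S : {set V}) (c2 : #|S| = 2) := steiner S (foundT S) c2.
have [m [n]] := card_points89 block_card T_disjoint T_balanced T_simple hom.
by rewrite hV => Ev; move: hv; rewrite !inE; lia.
Qed.
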